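(* Let $0<c_1<c_2<1$. There exist a function $f\in C^\infty(\mathbb{R}^2)$, bounded below and with Lipschitz continuous gradient, and a point $x_0\in\mathbb{R}^2$, such that every method of Class $\mathcal C$ started at $x_0$ with initial search direction $d_0=-g_0$, where $g_0=\nabla f(x_0)$ (with a symmetric positive definite initial matrix $H_0\succ0$, e.g. $H_0=I$, in the case of quasi-Newton members of the class), and equipped with the first-local-minimizer line search, generates iterates $x_{k+1}=x_k+s_k$ satisfying $\|s_k\|=1$ and $\|\nabla f(x_k)\|=1$ for all $k\ge 0$. Moreover, each step $s_k$ from $x_k$ satisfies the strong Wolfe, weak Wolfe, Armijo, and Goldstein conditions with constants $(c_1,c_2)$.
   Context: Norms and inner products are Euclidean. Line-search conditions. Let $f\in C^1(\mathbb{R}^n)$ and $0<c_1<c_2<1$. For a step $s$ from a nonstationary point $x$: - Armijo: $f(x+s)\le f(x)+c_1\langle\nabla f(x),s\rangle$. - Strong Wolfe: Armijo together with $|\langle\nabla f(x+s),s\rangle|\le c_2|\langle\nabla f(x),s\rangle|$. - Weak Wolfe: Armijo together with $\langle\nabla f(x+s),s\rangle\ge c_2\langle\nabla f(x),s\rangle$. - Goldstein: $f(x)+c_2\langle\nabla f(x),s\rangle\le f(x+s)\le f(x)+c_1\langle\nabla f(x),s\rangle$. Iterative methods. A method produces iterates $x_k$ and search directions $d_k$; write $g_k=\nabla f(x_k)$, $s_k=x_{k+1}-x_k$, $y_k=g_{k+1}-g_k$. The first-local-minimizer line search sets $x_{k+1}=x_k+t_kd_k$, where $t_k$ is the first (smallest)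 local minimizer of $\varphi(t)=f(x_k+td_k)$ on $t\ge0$. Class $\mathcal C$ is the class of iterative methods that, whenever $\langle g_{k+1},d_k\rangle=0$, produce a next direction $d_{k+1}$ satisfying $$\langle d_{k+1},y_k\rangle=0,\qquad \langle d_{k+1},g_{k+1}\rangle<0 .$$ (Quasi-Newton members of the class are methods with $d_k=-H_kg_k$, where $H_k$ is a matrix updated from a symmetric positive definite initial matrix $H_0$; examples of members of the class are BFGS, DFP, the Broyden positive family, L-BFGS with any memory $m\ge1$, and the Hestenes–Stiefel conjugate gradient method.) *)

(* Defs.v *)
From mathcomp Require Import all_boot all_order all_algebra.
From mathcomp Require Import all_classical all_reals all_analysis.
Import Order.TTheory GRing.Theory Num.Theory.
Import numFieldNormedType.Exports.

Set Implicit Arguments.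
Unset Strict Implicit.
Unset Printing Implicit Defensive.

Local Open Scope classical_set_scope.
Local Open Scope ring_scope.

(* The library norm `|x| on row vectors is the sup norm, hence dot and enorm. *)
Definition dot (R : realType) (n : nat) (u v : 'rV[R]_n) : R :=
  \sum_(i < n) u 0 i * v 0 i.

Definition enorm (R : realType) (n : nat) (u : 'rV[R]_n) : R :=
  Num.sqrt (dot u u).

Definition pderiv (R : realType) (n : nat) (i : 'I_n) (f : 'rV[R]_n -> R) :
    'rV[R]_n -> R :=
  fun x => 'D_(delta_mx 0 i) f x.

Definition grad (R : realType) (n : nat) (f : 'rV[R]_n -> R) (x : 'rV[R]_n) :
    'rV[R]_n :=
  \row_i pderiv i f x.

Fixpoint Cn (R : realType) (n k : nat) (f : 'rV[R]_n -> R) : Prop :=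
  match k with
  | 0 => continuous f
  | k'.+1 => (forall x, differentiable f x) /\
             (forall i : 'I_n, Cn k' (pderiv i f))
  end.

Definition Cinfty (R : realType) (n : nat) (f : 'rV[R]_n -> R) : Prop :=
  forall k, Cn k f.

Definition bounded_below (R : realType) (n : nat) (f : 'rV[R]_n -> R) : Prop :=
  exists b : R, forall x, b <= f x.

Definition lipschitz_grad (R : realType) (n : nat) (f : 'rV[R]_n -> R) : Prop :=
  exists L : R, forall x y, enorm (grad f x - grad f y) <= L * enorm (x - y).

Section LineSearchConditions.
Variables (R : realType) (n : nat) (f : 'rV[R]_n -> R) (c1 c2 : R).
Implicit Types x s : 'rV[R]_n.

Definition armijo x s : Prop := f (x + s) <= f x + c1 * dot (grad f x) s.

Definition strong_wolfe x s : Prop :=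
  armijo x s /\ `|dot (grad f (x + s)) s| <= c2 * `|dot (grad f x) s|.

Definition weak_wolfe x s : Prop :=
  armijo x s /\ dot (grad f (x + s)) s >= c2 * dot (grad f x) s.

Definition goldstein x s : Prop :=
  f x + c2 * dot (grad f x) s <= f (x + s) <= f x + c1 * dot (grad f x) s.

End LineSearchConditions.

(* Local minimizers are relative to the half-line t >= 0 and not necessarily
   strict; in particular t = 0 is allowed. *)
Definition local_minimizer (R : realType) (phi : R -> R) (t : R) : Prop :=
  0 <= t /\ \forall u \near t, 0 <= u -> phi t <= phi u.

Definition first_local_minimizer (R : realType) (phi : R -> R) (t : R) : Prop :=
  local_minimizer phi t /\ forall u, local_minimizer phi u -> t <= u.

(* An iterative method, without its line search, is an update rule acting on
   an internal memory of arbitrary type: H_k for BFGS, DFP and the Broyden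
   family, the stored pairs for L-BFGS, nothing for Hestenes-Stiefel.
   [update f m_k x_k d_k x_{k+1}] is (m_{k+1}, d_{k+1}).
   [admissible f x_0 d_0 m_0] says which initializations the method allows; for
   a quasi-Newton method it contains the requirement that the initial matrix
   H_0 stored in m_0 be symmetric positive definite. *)
Record method (R : realType) (n : nat) := Method {
  memory : Type;
  admissible : ('rV[R]_n -> R) -> 'rV[R]_n -> 'rV[R]_n -> memory -> Prop;
  update : ('rV[R]_n -> R) -> memory -> 'rV[R]_n -> 'rV[R]_n -> 'rV[R]_n ->
           memory * 'rV[R]_n
}.

Definition step (R : realType) (n : nat) (M : method R n) (f : 'rV[R]_n -> R)
    (x d : nat -> 'rV[R]_n) (m : nat -> memory M) (k : nat) : Prop :=
  (exists t : R,
     first_local_minimizer (fun u => f (x k + u *: d k)) t /\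
     x k.+1 = x k + t *: d k) /\
  (m k.+1, d k.+1) = update f (m k) (x k) (d k) (x k.+1).

(* Whether a method such as BFGS has the defining property at iteration k
   depends on how its memory was produced (H_k must be positive definite), so
   the property is required along the executions of the method, not from
   arbitrary internal states.  Finite prefixes are considered because an
   execution may fail to continue for lack of a local minimizer.  The property
   is void when g_{k+1} = 0, where no d_{k+1} can satisfy it and a method
   terminates. *)
Definition classC (R : realType) (n : nat) (M : method R n) : Prop :=
  forall (f : 'rV[R]_n -> R) (x d : nat -> 'rV[R]_n) (m : nat -> memory M)
    (k : nat),
    Cn 1 f ->
    admissible f (x 0) (d 0) (m 0) ->
    (forall j, (j <= k)%N -> step f x d m j) ->
    grad f (x k.+1) <> 0 ->
    dot (grad f (x k.+1)) (d k) = 0 ->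
    dot (d k.+1) (grad f (x k.+1) - grad f (x k)) = 0 /\
    dot (d k.+1) (grad f (x k.+1)) < 0.

Definition execution (R : realType) (n : nat) (M : method R n)
    (f : 'rV[R]_n -> R) (x0 d0 : 'rV[R]_n) (m0 : memory M)
    (x d : nat -> 'rV[R]_n) (m : nat -> memory M) : Prop :=
  [/\ x 0 = x0, d 0 = d0, m 0 = m0 & forall k, step f x d m k].

(* Main.v *)
Require Import Defs.
From mathcomp Require Import all_boot all_order all_algebra.
From mathcomp Require Import all_classical all_reals all_analysis.
From mathcomp Require Import ring lra.
Import Order.TTheory GRing.Theory Num.Theory.
Import numFieldNormedType.Exports.

(** In the plane, the class condition leaves no
    choice of direction: if the gradients at two successive iterates are unit
    vectors and the search was exact, the next direction is orthogonal to their
    difference, hence lies on the bisector of the two gradients, and descent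
    fixes its orientation.  Starting from steepest descent this gives angles
    that can be computed once and for all.  With the angle [pi / (3 2^k)], of
    cosine [cosk k] and sine [sink k], the k-th gradient and unit step are
    [[
      gvec k = (- sin, (-1)^k cos) (pi / (3 2^k)),
      dir k  = (cos, - (-1)^k sin) (pi / (3 2^(k+1))).
    ]]
    The steps turn towards a fixed direction while the gradients turn
    orthogonally to it, with alternating orientation; the slope of the k-th
    step is [- slope k], of order [2^-k].  So the decrease
    [c1 * slope k] imposed by the Armijo condition is summable, and a function
    bounded below can afford it although no step is ever short.

    It remains to find a smooth function with these gradients at the points
    [node k], with values [level c k] decreasing by exactly [c * slope k], and
    without local minimizer along a segment before its end.  Let [taylor k] be
    the affine function with the prescribed value and gradient at [node k].  Over
    the strip between the abscissas of [node k] and [node k.+1] the objective is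
    [[
      (1 - switch) taylor k + switch taylor k.+1 + c * slope k / 2 * lift_off
    ]]
    where [switch] is a smooth step in the reduced abscissa and [lift_off] a
    fixed bump.  Along the segment [taylor k.+1] is constant, because the next
    gradient is orthogonal to the step, and the objective equals
    [level c k - slope k * descent c t] for one universal increasing function
    [descent c] that goes from 0 to [c] ([objective_path], [descent_lt]).  Just
    past the segment the objective is [taylor k.+1], constant in the
    direction of the step, so that the end of the segment is a (non-strict) local
    minimizer, and the first one ([line_search]).

    The ordinate only enters these formulas affinely.  Replacing it by a
    compactly supported function that is the identity near the path makes the
    objective of the form [A x + B x * psi y], where [A] and [B] are glued from
    one-variable pieces which are all obtained from three fixed functions by
    scalings with bounded coefficients; this gives smoothness and the Lipschitz
    gradient ([tame_glued], [lipschitz_grad_model]).  The lower bound comes from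
    the geometric decay of [sink] ([level_bound], [nodeY_bound]). *)

Set Implicit Arguments.
Unset Strict Implicit.
Unset Printing Implicit Defensive.

Local Open Scope classical_set_scope.
Local Open Scope ring_scope.

(** * Smooth functions of one variable *)

Section SmoothFunctions.
Context {R : realType}.
Implicit Types (g h : R -> R) (a b x y : R).

(** The derivative is existentially quantified so that a closure property is
    proved by exhibiting a differentiation formula; uniqueness of derivatives
    ([derive1_unique]) then identifies it with [derive1]. *)
Fixpoint Ck (k : nat) g : Prop :=
  if k is k'.+1 then
    exists2 g', forall x, is_derive x 1 g (g' x) & Ck k' g'
  else True.

Definition smooth g : Prop := forall k, Ck k g.

Lemma derive1_unique g g' :
  (forall x, is_derive x 1 g (g' x)) -> derive1 g = g'.
Proof. by move=> gg'; apply/funext => x; rewrite derive1E; apply: derive_val. Qed.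

Lemma smooth_is_derive g x : smooth g -> is_derive x 1 g (derive1 g x).
Proof. by move=> /(_ 1%N)[g' gg' _]; rewrite (derive1_unique gg'). Qed.

Lemma smooth_derive1 g : smooth g -> smooth (derive1 g).
Proof. by move=> gs k; have [g' gg' ?] := gs k.+1; rewrite (derive1_unique gg'). Qed.

Lemma smooth_continuous g : smooth g -> continuous g.
Proof.
move=> gs x; apply/differentiable_continuous/derivable1_diffP.
by have [] := smooth_is_derive x gs.
Qed.

Lemma smooth_cst a : smooth (fun=> a).
Proof.
move=> k; elim: k a => //= k IH a; exists (fun=> 0) => // x.
exact: is_derive_cst.
Qed.

Lemma CkS k g : Ck k.+1 g -> Ck k g.
Proof.
elim: k g => // k IH g [g' gg' g'k]; exists g' => //; exact: IH.
Qed.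

Lemma CkD k g h : Ck k g -> Ck k h -> Ck k (fun x => g x + h x).
Proof.
elim: k g h => // k IH g h [g' gg' g'k] [h' hh' h'k].
by exists (fun x => g' x + h' x); [move=> x; exact: is_deriveD | exact: IH].
Qed.

Lemma CkM k g h : Ck k g -> Ck k h -> Ck k (fun x => g x * h x).
Proof.
elim: k g h => // k IH g h gk hk.
have [g' gg' g'k] := gk; have [h' hh' h'k] := hk.
exists (fun x => g x * h' x + h x * g' x); first by move=> x; exact: is_deriveM.
by apply: CkD; apply: IH => //; exact: CkS.
Qed.

Lemma smooth_id : smooth id.
Proof.
case=> [//|k]; exists (fun=> 1) => [x|]; first exact: is_derive_id.
exact: smooth_cst.
Qed.

Lemma smoothD g h : smooth g -> smooth h -> smooth (fun x => g x + h x).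
Proof. by move=> gs hs k; apply: CkD. Qed.

Lemma smoothM g h : smooth g -> smooth h -> smooth (fun x => g x * h x).
Proof. by move=> gs hs k; apply: CkM. Qed.

Lemma smoothN g : smooth g -> smooth (fun x => - g x).
Proof.
move=> gs; rewrite (_ : (fun x => - g x) = (fun x => -1 * g x)).
  by apply: smoothM => //; exact: smooth_cst.
by apply/funext => x; rewrite mulN1r.
Qed.

Lemma smoothB g h : smooth g -> smooth h -> smooth (fun x => g x - h x).
Proof. by move=> gs hs; apply: smoothD => //; exact: smoothN. Qed.

Lemma smoothV g : smooth g -> (forall x, g x != 0) ->
  smooth (fun x => (g x)^-1).
Proof.
move=> gs gn0; elim=> // k IH.
exists (fun x => - (derive1 g x) * ((g x)^-1 * (g x)^-1)) => [x|].
  apply: is_derive_eq; first exact: (is_deriveV (gn0 x) (smooth_is_derive x gs)).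
  by rewrite /= -[_ *: _]/(_ * _) mulrC -exprVn expr2 mulrN mulNr.
apply: CkM; last exact: CkM.
by apply: smoothN; exact: smooth_derive1.
Qed.

Lemma is_derive_affine a b x : is_derive x 1 (fun z => a * z + b) a.
Proof.
have H : is_derive x 1 (a \*: (@id R) + cst b) (a *: (1 : R) + 0).
  by apply: is_deriveD.
by move: H; rewrite addr0 -[_ *: _]/(_ * _) mulr1.
Qed.

Lemma smooth_affine_comp g a b : smooth g -> smooth (fun x => g (a * x + b)).
Proof.
move=> gs k; move: (gs k) => {gs}; elim: k g => // k IH g [g' gg' g'k].
exists (fun x => g' (a * x + b) * a) => [x|].
  apply: (@is_derive1_comp _ g (fun x => a * x + b)) => //.
  exact: is_derive_affine.
by apply: CkM; [exact: IH | exact: smooth_cst].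
Qed.

Lemma derive1_affine_comp g a b x : smooth g ->
  derive1 (fun x => g (a * x + b)) x = a * derive1 g (a * x + b).
Proof.
move=> gs; rewrite derive1E; apply: derive_val.
rewrite mulrC; apply: (@is_derive1_comp _ g (fun x => a * x + b)).
  exact: smooth_is_derive.
exact: is_derive_affine.
Qed.

Lemma derive1_near g h x : (\forall z \near x, g z = h z) ->
  derive1 g x = derive1 h x.
Proof. by move=> gh; rewrite !derive1E; apply: near_eq_derive. Qed.

Lemma near_derive1 g h x : (\forall z \near x, g z = h z) ->
  \forall z \near x, derive1 g z = derive1 h z.
Proof. by move=> /nbhs_interior; apply: filterS => z; apply: derive1_near. Qed.

Lemma smooth_local g :
  (forall x, exists2 h, smooth h & \forall z \near x, g z = h z) -> smooth g.
Proof.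
move=> gl k; elim: k g gl => // k IH g gl; exists (derive1 g) => [x|].
  have [h hs gh] := gl x.
  have hg : \forall z \near x, h z = g z by apply: filterS gh.
  apply: (near_eq_is_derive hg); rewrite (derive1_near gh).
  exact: smooth_is_derive.
apply: IH => x; have [h hs gh] := gl x; exists (derive1 h).
  exact: smooth_derive1.
exact: near_derive1.
Qed.

Lemma derive1_bounded_lipschitz g K : smooth g -> (forall x, `|derive1 g x| <= K) ->
  forall x y, `|g x - g y| <= K * `|x - y|.
Proof.
move=> gs gK.
suff H x y : x <= y -> `|g y - g x| <= K * `|y - x|.
  move=> x y; case: (leP x y) => [/H|/ltW /H //].
  by rewrite -normrN opprB -[`|y - x|]normrN opprB.
move=> xy; have [||c _ ->] := @MVT_segment R g (derive1 g) x y xy.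
- by move=> z _; exact: smooth_is_derive.
- by apply: continuous_subspaceT; exact: smooth_continuous.
by rewrite normrM ler_wpM2r.
Qed.

Lemma bounded_outside_segment g a b M : a <= b -> continuous g ->
  (forall x, x < a -> `|g x| <= M) -> (forall x, b < x -> `|g x| <= M) ->
  exists K, forall x, `|g x| <= K.
Proof.
move=> ab gc ga gb.
have ngc : {within `[a, b]%classic, continuous (fun x => `|g x|)}.
  apply: continuous_subspaceT => x.
  by apply: (@continuous_comp _ _ _ g (fun x => `|x|)); [exact: gc | exact: norm_continuous].
have [c _ cmax] := EVT_max ab ngc.
exists (Num.max M `|g c|) => x; rewrite le_max.
have [/ga ->//|ax] := ltP x a; have [/gb ->//|xb] := ltP b x.
by rewrite cmax ?orbT// in_itv/= ax.
Qed.

End SmoothFunctions.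

(** * A smooth step *)

Section SmoothStep.
Context {R : realType}.
Implicit Types (x y : R) (n : nat).

(** The powers [x^-n] are there to make this family stable, up to linear
    combinations, under differentiation. *)
Definition flat n x : R := if 0 < x then x^-1 ^+ n * expR (- x^-1) else 0.

(** The exponential [exp (1/x)] dominates the term of degree n+1 of its power
    series. *)
Lemma flat_le n x : 0 < x -> flat n x <= n.+1`!%:R * x.
Proof.
move=> x0; rewrite /flat x0 expRN -[X in X <= _]/(_ / _) ler_pdivrMr ?expR_gt0//.
have x1 : 0 <= x^-1 by rewrite invr_ge0 ltW.
have := expR_ge1Dxn n x1.
have f0 : 0 < n.+1`!%:R :> R by rewrite ltr0n fact_gt0.
move=> H; have {H} : x^-1 ^+ n.+1 / n.+1`!%:R <= expR x^-1 by apply: le_trans H; rewrite lerDr.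
rewrite ler_pdivrMr// exprS => H.
have -> : x^-1 ^+ n = x * (x^-1 * x^-1 ^+ n) by rewrite mulrA mulfV ?gt_eqF// mul1r.
by rewrite [_%:R * x]mulrC -mulrA ler_pM2l// [_%:R * _]mulrC.
Qed.

Lemma flat_ge0 n x : 0 <= flat n x.
Proof.
rewrite /flat; case: ifP => // x0.
by rewrite mulr_ge0 ?expR_ge0// exprn_ge0// invr_ge0 ltW.
Qed.

Lemma flat_le0 n x : x <= 0 -> flat n x = 0.
Proof. by rewrite /flat; case: ltP. Qed.

(** At 0 the growth rate of [flat n] is [flat n.+1], which is continuous there;
    elsewhere this is a computation. *)
Lemma is_derive_flat n x :
  is_derive x 1 (flat n) (flat n.+2 x - n%:R * flat n.+1 x).
Proof.
have [x0|x0|->] := ltgtP x 0.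
- rewrite !flat_le0 ?ltW// mulr0 subr0.
  apply: (@near_eq_is_derive R R R (cst 0)).
  near=> z; rewrite flat_le0//; apply/ltW; near: z; exact: lt_nbhsl.
- apply: (@near_eq_is_derive R R R (fun z => (fun y => y ^+ n * expR (- y)) z^-1)).
    near=> z; rewrite /flat ifT//; near: z; exact: lt_nbhsr.
  have xn0 : x != 0 by rewrite gt_eqF.
  rewrite /flat x0.
  have dV : is_derive x 1 (fun z : R => z^-1) (- x ^- 2 *: 1).
    exact: (@is_deriveV _ id).
  have dE : is_derive x^-1 1 (fun y => expR (- y)) (expR (- x^-1) * -1).
    exact: (@is_derive1_comp _ expR (fun y => - y)).
  have dX : is_derive x^-1 1 (fun y : R => y ^+ n) (n%:R * x^-1 ^+ n.-1).
    apply: DeriveDef; first exact: exprn_derivable.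
    by rewrite exp_derive -[_ *: _]/(_ * _) mulr1.
  have dM := is_deriveM dX dE.
  apply: is_derive_eq; first exact: (@is_derive1_comp _ (fun y => y ^+ n * expR (- y)) (fun z => z^-1) _ _ _ dM dV).
  rewrite /= -![_ *: _]/(_ * _).
  case: n {dX dM} => [|n] /=; rewrite -?exprVn ?exprS; by field.
- apply/is_derive1_caratheodory; exists (flat n.+1); split.
  + move=> z; rewrite /flat ltxx !subr0; case: ifP => [z0|_]; last by rewrite mul0r.
    by rewrite exprS; field; rewrite gt_eqF.
  + apply/cvgrPdist_lt => e e0; rewrite [in flat _ 0]flat_le0//.
    near=> z; rewrite sub0r normrN ger0_norm ?flat_ge0//.
    have [z0|z0] := leP z 0; first by rewrite flat_le0.
    apply: le_lt_trans (flat_le _ z0) _.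
    rewrite mulrC -ltr_pdivlMr ?ltr0n ?fact_gt0//.
    by near: z; apply: lt_nbhsl; rewrite divr_gt0 ?ltr0n ?fact_gt0.
  + by rewrite !flat_le0// mulr0 subr0.
Unshelve. all: by end_near. Qed.

Lemma smooth_flat n : smooth (flat n).
Proof.
move=> k; elim: k n => // k IH n.
exists (fun x => flat n.+2 x + (- n%:R) * flat n.+1 x) => [x|].
  by rewrite mulNr; exact: is_derive_flat.
by apply: CkD => //; apply: CkM => //; exact: smooth_cst.
Qed.

Lemma flat0_lt x y : 0 < y -> x < y -> flat 0 x < flat 0 y.
Proof.
move=> y0 xy; rewrite /flat y0 !mul1r.
case: ifP => [x0|_]; last exact: expR_gt0.
by rewrite ltr_expR ltrN2 ltf_pV2.
Qed.

Definition sstep x : R := flat 0 x / (flat 0 x + flat 0 (1 - x)).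

Let sstep_den x : 0 < flat 0 x + flat 0 (1 - x).
Proof.
have [x0|x0] := ltP 0 x.
  by rewrite ltr_wpDr ?flat_ge0// -(@flat_le0 0 0)// flat0_lt.
by rewrite ltr_wpDl ?flat_ge0// -(@flat_le0 0 0)// flat0_lt; lra.
Qed.

Lemma smooth_sstep : smooth sstep.
Proof.
have f1 : smooth (fun x => flat 0 (1 - x)).
  rewrite (_ : (fun x => _) = (fun x => flat 0 (-1 * x + 1))).
    exact: smooth_affine_comp (smooth_flat 0).
  by apply/funext => x; rewrite mulN1r addrC.
apply: smoothM; first exact: smooth_flat.
apply: smoothV => [|x]; last by rewrite gt_eqF.
by apply: smoothD => //; exact: smooth_flat.
Qed.

Lemma sstep_le0 x : x <= 0 -> sstep x = 0.
Proof. by move=> x0; rewrite /sstep flat_le0// mul0r. Qed.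

Lemma sstep_ge1 x : 1 <= x -> sstep x = 1.
Proof.
move=> x1; have := sstep_den x; rewrite /sstep [flat 0 (1 - x)]flat_le0 ?subr_le0//.
by rewrite addr0 => d0; rewrite divff ?gt_eqF.
Qed.

Lemma sstep_bounds x : 0 <= sstep x <= 1.
Proof.
rewrite /sstep divr_ge0 ?flat_ge0 ?(ltW (sstep_den x))//=.
by rewrite ler_pdivrMr// mul1r lerDl flat_ge0.
Qed.

(** Clearing denominators, the numerator increases and [flat 0 (1 - x)]
    decreases. *)
Lemma sstep_lt x y : x < y -> 0 < y -> x < 1 -> sstep x < sstep y.
Proof.
move=> xy y0 x1; rewrite /sstep ltr_pdivrMr// mulrAC ltr_pdivlMr//.
rewrite !mulrDr [flat 0 x * flat 0 y]mulrC ltrD2l.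
have a : flat 0 x < flat 0 y by apply: flat0_lt.
have b : flat 0 (1 - y) < flat 0 (1 - x) by apply: flat0_lt; lra.
have := flat_ge0 0 x; have := flat_ge0 0 (1 - y); nra.
Qed.

Lemma sstep_le x y : x <= y -> sstep x <= sstep y.
Proof.
rewrite le_eqVlt => /predU1P[->//|xy].
have [x1|x1] := ltP x 1; last by rewrite !sstep_ge1//; lra.
have [y0|y0] := ltP 0 y; last by rewrite !sstep_le0//; lra.
by rewrite ltW// sstep_lt.
Qed.

Definition trunc_id x : R := x * sstep (3 + x) * sstep (3 - x).

Lemma trunc_idE x : -2 <= x <= 2 -> trunc_id x = x.
Proof. by move=> x2; rewrite /trunc_id !sstep_ge1 ?mulr1//; lra. Qed.

Lemma trunc_id_out x : (x < -3) || (3 < x) -> trunc_id x = 0.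
Proof.
rewrite /trunc_id => /orP[x3|x3].
  by rewrite [sstep (3 + x)]sstep_le0 ?mulr0 ?mul0r//; lra.
by rewrite [sstep (3 - x)]sstep_le0 ?mulr0//; lra.
Qed.

Lemma trunc_id_bound x : `|trunc_id x| <= 3.
Proof.
have [xo|/norP[]] := boolP ((x < -3) || (3 < x)).
  by rewrite trunc_id_out// normr0; lra.
rewrite -!leNgt => x3 x3'; rewrite /trunc_id -mulrA normrM -[leRHS]mulr1.
have /andP[a b] := sstep_bounds (3 + x); have /andP[a' b'] := sstep_bounds (3 - x).
apply: ler_pM => //; first by rewrite ler_norml x3.
by rewrite normrM !ger0_norm// mulr_ile1.
Qed.

Lemma smooth_trunc_id : smooth trunc_id.
Proof.
apply: smoothM; first apply: smoothM; first exact: smooth_id.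
  rewrite (_ : (fun x => _) = (fun x => sstep (1 * x + 3))).
    exact: smooth_affine_comp smooth_sstep.
  by apply/funext => x; rewrite mul1r addrC.
rewrite (_ : (fun x => _) = (fun x => sstep (-1 * x + 3))).
  exact: smooth_affine_comp smooth_sstep.
by apply/funext => x; rewrite mulN1r addrC.
Qed.

End SmoothStep.

(** * The zigzag *)

Section Zigzag.
Context {R : realType}.
Implicit Types (k : nat) (c : R).

(** [cosk k] and [sink k] are the cosine and sine of [pi / (3 2^k)]; only
    the half-angle formulas are used. *)
Fixpoint cosk k : R := if k is k'.+1 then Num.sqrt ((1 + cosk k') / 2) else 1 / 2.

Definition sink k : R := Num.sqrt (1 - cosk k ^+ 2).

Lemma cosk_bounds k : 1 / 2 <= cosk k < 1.
Proof.
elim: k => [|k IH] /=; first by lra.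
have -> : 1 / 2 = Num.sqrt ((1 / 2) ^+ 2) :> R by rewrite sqrtr_sqr ger0_norm//; lra.
rewrite -[X in _ < X]sqrtr1 ler_sqrt ?ltr_sqrt//; [nra|lra].
Qed.

Lemma cosk_half k : cosk k = 2 * cosk k.+1 ^+ 2 - 1.
Proof.
have b := cosk_bounds k; rewrite /= sqr_sqrtr; last by lra.
by field.
Qed.

Lemma coskS_ge k : 4 / 5 <= cosk k.+1.
Proof.
have e := cosk_half k; have /andP[a _] := cosk_bounds k.
have /andP[b _] := cosk_bounds k.+1; rewrite leNgt; apply/negP => l; nra.
Qed.

Lemma sink_sqr k : sink k ^+ 2 = 1 - cosk k ^+ 2.
Proof.
by have /andP[a b] := cosk_bounds k; rewrite /sink sqr_sqrtr// subr_ge0; nra.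
Qed.

Lemma sink_gt0 k : 0 < sink k.
Proof. by have /andP[a b] := cosk_bounds k; rewrite /sink sqrtr_gt0; nra. Qed.

Lemma sink_half k : sink k = 2 * sink k.+1 * cosk k.+1.
Proof.
have := sink_gt0 k; have := sink_gt0 k.+1; have := coskS_ge k.
have := sink_sqr k; have := sink_sqr k.+1; have := cosk_half k => -> a b d e f.
apply/eqP; rewrite -(@eqrXn2 _ 2)//; first last; [nra|nra|].
by rewrite b; apply/eqP; rewrite !exprMn a; ring.
Qed.

(** The geometric decay behind all the summability statements below: each
    telescopes the sum against a multiple of [sink]. *)
Lemma sink_decay k : sink k.+1 <= 5 / 8 * sink k.
Proof.
by have := sink_half k; have := sink_gt0 k.+1; have := coskS_ge k; nra.
Qed.

Lemma sink_le1 k : sink k <= 1.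
Proof. by have := sink_sqr k; have := cosk_bounds k; have := sink_gt0 k; nra. Qed.

(** [sink0] and [sink1] say that pi/3 and pi/6 are complementary: this is
    what makes the first step a steepest descent step. *)
Lemma sink0 : sink 0 = cosk 1.
Proof.
rewrite /sink /=; congr (Num.sqrt _); lra.
Qed.

Lemma sink1 : sink 1 = cosk 0.
Proof.
have := sink_half 0; rewrite sink0 /=; have := coskS_ge 0 => /=; nra.
Qed.

(** In angles, [sin (4a - a) = sin (2a + a)] with [a = pi / (3 2^(k+2))]; it
    says that the step k+1 is orthogonal to the difference of the gradients k
    and k+1. *)
Lemma bisector_identity k :
  cosk k.+2 * (sink k - sink k.+1) = sink k.+2 * (cosk k + cosk k.+1).
Proof.
rewrite (sink_half k) (cosk_half k) (sink_half k.+1) (cosk_half k.+1); ring.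
Qed.

Fixpoint nodeX k : R := if k is k'.+1 then nodeX k' + cosk k else 0.

Fixpoint nodeY k : R := if k is k'.+1 then nodeY k' - (-1) ^+ k' * sink k else 0.

(** The sine of the sum of the angles k and k+1; [- slope k] is the directional
    derivative of the objective at the start of the k-th step. *)
Definition slope k : R := sink k * cosk k.+1 + cosk k * sink k.+1.

Fixpoint level c k : R := if k is k'.+1 then level c k' - c * slope k' else 0.

Lemma slope_gt0 k : 0 < slope k.
Proof.
have := sink_gt0 k; have := sink_gt0 k.+1.
by have := cosk_bounds k; have := cosk_bounds k.+1; rewrite /slope; nra.
Qed.

Lemma slope_le k : slope k <= 2 * sink k.
Proof.
have := sink_gt0 k; have := sink_gt0 k.+1; have := sink_decay k.
by have := cosk_bounds k; have := cosk_bounds k.+1; rewrite /slope; nra.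
Qed.

Lemma nodeX_ge k : 4 / 5 * k%:R <= nodeX k.
Proof.
elim: k => [|k IH]; first by rewrite mulr0.
by rewrite /nodeX -/nodeX -natr1; have := coskS_ge k; lra.
Qed.

Lemma nodeY_bound k : `|nodeY k| + 2 * sink k <= 2.
Proof.
suff : `|nodeY k| <= 2 * (sink 0 - sink k) by have := sink_le1 0; lra.
elim: k => [|k IH]; first by rewrite /= normr0 subrr mulr0.
rewrite /nodeY -/nodeY; apply: le_trans (ler_normB _ _) _.
rewrite normrM normrX normrN1 expr1n mul1r (gtr0_norm (sink_gt0 _)).
by have := sink_decay k; have := sink_gt0 k; lra.
Qed.

Lemma level_bound c k : 0 < c < 1 -> -6 <= level c k <= 0.
Proof.
move=> c01; suff : - (6 * (sink 0 - sink k)) <= level c k <= 0.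
  by have := sink_gt0 k; have := sink_le1 0; lra.
elim: k => [|k IH] /=; first by rewrite subrr mulr0 oppr0 lexx.
have := sink_decay k; have := sink_gt0 k; have := slope_le k; have := slope_gt0 k.
nra.
Qed.

End Zigzag.

(** * Uniform bounds on first and second derivatives *)

Section Tame.
Context {R : realType}.
Implicit Types (g h : R -> R) (a b x y K L : R).

(** The bound is explicit because it must be shared by the infinitely many
    pieces of the construction; both properties are local and survive
    glueing. *)
Definition tame K g : Prop :=
  [/\ smooth g, forall x, `|derive1 g x| <= K &
      forall x, `|derive1 (derive1 g) x| <= K].

Lemma tame_weaken K L g : K <= L -> tame K g -> tame L g.
Proof.
by move=> KL [gs g1 g2]; split=> // x; [apply: le_trans (g1 x) _ | apply: le_trans (g2 x) _].
Qed.

Lemma derive1_add g h : smooth g -> smooth h ->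
  derive1 (fun x => g x + h x) = fun x => derive1 g x + derive1 h x.
Proof.
by move=> gs hs; apply: derive1_unique => x; apply: is_deriveD; exact: smooth_is_derive.
Qed.

Lemma derive1_mul g h : smooth g -> smooth h ->
  derive1 (fun x => g x * h x) = fun x => g x * derive1 h x + h x * derive1 g x.
Proof.
by move=> gs hs; apply: derive1_unique => x; apply: is_deriveM; exact: smooth_is_derive.
Qed.

Lemma derive1_affine a b : derive1 (fun x => a * x + b) = fun=> a.
Proof. by apply: derive1_unique => x; exact: is_derive_affine. Qed.

Lemma smooth_affine a b : smooth (fun x => a * x + b).
Proof. exact: (smooth_affine_comp a b smooth_id). Qed.

Lemma tame_affine a b : tame `|a| (fun x => a * x + b).
Proof.
split=> [|x|x]; [exact: smooth_affine|by rewrite derive1_affine|].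
by rewrite derive1_affine (derive1_cst a) normr0.
Qed.

Lemma tame_add K L g h : tame K g -> tame L h -> tame (K + L) (fun x => g x + h x).
Proof.
move=> [gs g1 g2] [hs h1 h2]; split=> [|x|x]; first exact: smoothD.
  by rewrite derive1_add// (le_trans (ler_normD _ _))// lerD.
by rewrite !derive1_add ?(le_trans (ler_normD _ _)) ?lerD//; exact: smooth_derive1.
Qed.

Lemma tame_scale a K g : tame K g -> tame (`|a| * K) (fun x => a * g x).
Proof.
move=> [gs g1 g2]; have as_ := smooth_cst a.
have d f : smooth f -> derive1 (fun x => a * f x) = fun x => a * derive1 f x.
  move=> fs; rewrite derive1_mul//; apply/funext => x.
  by rewrite (derive1_cst a) mulr0 addr0.
split=> [|x|x]; first exact: smoothM.
  by rewrite d// normrM ler_wpM2l.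
by rewrite !d ?normrM ?ler_wpM2l//; exact: smooth_derive1.
Qed.

Lemma tame_affine_comp a b K L g : 0 <= K -> `|a| <= L -> 1 <= L -> tame K g ->
  tame (L ^+ 2 * K) (fun x => g (a * x + b)).
Proof.
move=> K0 aL L1 [gs g1 g2].
have d f : smooth f ->
    derive1 (fun x => f (a * x + b)) = fun x => a * derive1 f (a * x + b).
  by move=> fs; apply/funext => x; exact: derive1_affine_comp.
have a0 := normr_ge0 a.
split=> [|x|x]; first exact: smooth_affine_comp.
  rewrite d// normrM; apply: (@le_trans _ _ (L * K)); first exact: ler_pM.
  by rewrite ler_wpM2r// expr2 ler_peMr// (le_trans _ L1).
rewrite d// derive1_mul; [|exact: smooth_cst|by apply: smooth_affine_comp; exact: smooth_derive1].
rewrite (derive1_cst a) mulr0 addr0 d; last exact: smooth_derive1.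
rewrite mulrA normrM normrM -expr2.
apply: ler_pM => //.
by rewrite lerXn2r// nnegrE (le_trans _ L1).
Qed.

Lemma tame_local K g :
  (forall x, exists2 h, tame K h & \forall z \near x, g z = h z) -> tame K g.
Proof.
move=> gl; split=> [|x|x].
- by apply: smooth_local => x; have [h [hs _ _] gh] := gl x; exists h.
- by have [h [_ h1 _] gh] := gl x; rewrite (derive1_near gh).
- have [h [_ _ h2] gh] := gl x.
  by rewrite (derive1_near (near_derive1 gh)).
Qed.

(** Both derivatives are constant off a compact segment, on which they are
    bounded by continuity. *)
Lemma tame_affine_outside g a b l0 l1 r0 r1 : a <= b -> smooth g ->
  (forall x, x < a -> g x = l1 * x + l0) ->
  (forall x, b < x -> g x = r1 * x + r0) -> exists2 K, 0 <= K & tame K g.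
Proof.
move=> ab gs gl gr; have g's := smooth_derive1 gs; have g''s := smooth_derive1 g's.
have nl x : x < a -> \forall z \near x, g z = l1 * z + l0.
  by move=> xa; near=> z; apply: gl; near: z; exact: lt_nbhsl.
have nr x : b < x -> \forall z \near x, g z = r1 * z + r0.
  by move=> xa; near=> z; apply: gr; near: z; exact: lt_nbhsr.
have [K1 gK1] : exists K, forall x, `|derive1 g x| <= K.
  apply: (@bounded_outside_segment _ _ a b (Num.max `|l1| `|r1|)) => //.
  - exact: smooth_continuous.
  - by move=> x /nl/derive1_near ->; rewrite derive1_affine le_max lexx.
  - by move=> x /nr/derive1_near ->; rewrite derive1_affine le_max lexx orbT.
have [K2 gK2] : exists K, forall x, `|derive1 (derive1 g) x| <= K.
  apply: (@bounded_outside_segment _ _ a b 0) => //.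
  - exact: smooth_continuous.
  - by move=> x /nl/near_derive1/derive1_near ->; rewrite derive1_affine (derive1_cst l1) normr0.
  - by move=> x /nr/near_derive1/derive1_near ->; rewrite derive1_affine (derive1_cst r1) normr0.
exists (Num.max K1 K2); first by rewrite le_max (le_trans _ (gK1 0)).
by split=> // x; rewrite le_max ?gK1 ?gK2 ?orbT.
Unshelve. all: by end_near. Qed.

Lemma tame_lipschitz K g : tame K g -> forall x y, `|g x - g y| <= K * `|x - y|.
Proof. by move=> [gs g1 _]; exact: derive1_bounded_lipschitz. Qed.

Lemma tame_derive1_lipschitz K g : tame K g ->
  forall x y, `|derive1 g x - derive1 g y| <= K * `|x - y|.
Proof. by move=> [gs _ g2]; apply: derive1_bounded_lipschitz => //; exact: smooth_derive1. Qed.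

(** A smooth function that is affine to the right of a point has there the
    derivative of this affine function, by continuity of the derivative. *)
Lemma derive1_affine_right g a b x e : 0 < e -> smooth g ->
  (forall z, x <= z < x + e -> g z = a * z + b) -> derive1 g x = a.
Proof.
move=> e0 gs ga.
have gc : derive1 g z @[z --> x^'+] --> derive1 g x.
  by apply: cvg_at_right_filter; exact: (smooth_continuous (smooth_derive1 gs)).
have gc' : derive1 g z @[z --> x^'+] --> a.
  apply: (@cvg_trans _ ((fun=> a) z @[z --> x^'+])); last exact: cvg_cst.
  apply: near_eq_cvg; near=> z.
  have zx : x < z by near: z; exact: nbhs_right_gt.
  have ze : z < x + e by near: z; apply: nbhs_right_lt; rewrite ltrDl.
  rewrite -[LHS](congr1 (fun f => f z) (derive1_affine a b)).
  apply: derive1_near; near=> w; rewrite ga// ltW/=.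
    by near: w; exact: lt_nbhsl.
  by near: w; exact: lt_nbhsr.
exact: (cvg_unique _ gc gc').
Unshelve. all: by end_near. Qed.

Lemma tame_trunc_id :  exists2 K, 0 <= K & tame K (@trunc_id R).
Proof.
apply: (@tame_affine_outside _ (-3) 3 0 0 0 0); first by lra.
- exact: smooth_trunc_id.
- by move=> x x3; rewrite trunc_id_out ?x3// mul0r addr0.
- by move=> x x3; rewrite trunc_id_out ?x3 ?orbT// mul0r addr0.
Qed.

End Tame.

(** * Glueing affine functions along the abscissa *)

Section Glueing.
Context {R : realType}.
Variable c : R.
Hypothesis c01 : 0 < c < 1.
Implicit Types (k : nat) (t x : R) (al be e : nat -> R).

(** [switch] rises from 0 to 1 on [c/4, c/2] and [ramp] on [c/4, 1]: both
    vanish on [0, c/4], so that each piece starts affine, and [ramp] is still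
    increasing up to 1, where the next piece starts. *)
Definition switch t : R := sstep (4 / c * t + (-1)).

Definition ramp t : R := sstep (4 / (4 - c) * t + - (c / (4 - c))).

Let c0 : 0 < c. Proof. by case/andP: c01. Qed.
Let c4 : 0 < 4 - c. Proof. by case/andP: c01; lra. Qed.

Let switch_arg t : 4 / c * t + (-1) = (4 * t - c) / c.
Proof. by field; rewrite gt_eqF. Qed.

Let ramp_arg t : 4 / (4 - c) * t + - (c / (4 - c)) = (4 * t - c) / (4 - c).
Proof. by field; rewrite gt_eqF. Qed.

Lemma switch_eq0 t : t <= c / 4 -> switch t = 0.
Proof. by move=> tc; rewrite /switch switch_arg sstep_le0// ler_pdivrMr//; lra. Qed.

Lemma switch_eq1 t : c / 2 <= t -> switch t = 1.
Proof. by move=> tc; rewrite /switch switch_arg sstep_ge1// ler_pdivlMr//; lra. Qed.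

Lemma switch_bounds t : 0 <= switch t <= 1.
Proof. exact: sstep_bounds. Qed.

Lemma switch_le s t : s <= t -> switch s <= switch t.
Proof.
move=> st; rewrite /switch !switch_arg; apply: sstep_le.
by rewrite ler_pM2r ?invr_gt0//; lra.
Qed.

Lemma ramp_eq0 t : t <= c / 4 -> ramp t = 0.
Proof. by move=> tc; rewrite /ramp ramp_arg sstep_le0// ler_pdivrMr//; lra. Qed.

Lemma ramp_eq1 t : 1 <= t -> ramp t = 1.
Proof. by move=> tc; rewrite /ramp ramp_arg sstep_ge1// ler_pdivlMr//; lra. Qed.

Lemma ramp_bounds t : 0 <= ramp t <= 1.
Proof. exact: sstep_bounds. Qed.

Lemma ramp_lt s t : s < t -> c / 4 < t -> s < 1 -> ramp s < ramp t.
Proof.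
move=> st ct s1; rewrite /ramp !ramp_arg; apply: sstep_lt.
- by rewrite ltr_pM2r ?invr_gt0//; lra.
- by rewrite divr_gt0//; lra.
- by rewrite ltr_pdivrMr//; lra.
Qed.

Definition lift_off t : R := switch t - ramp t.

Definition reduced k x : R := (x - nodeX k) / cosk k.+1.

Let h0 k : 0 < cosk k.+1 :> R.
Proof. by have := coskS_ge (R := R) k; lra. Qed.

Definition line al be k x : R := al k + be k * (x - nodeX k).

Definition piece al be e k x : R :=
  (1 - switch (reduced k x)) * line al be k x
  + switch (reduced k x) * line al be k.+1 x
  + e k * lift_off (reduced k x).

Lemma strip_exists x : exists k, x <= nodeX k.+1.
Proof.
exists (Num.trunc (5 / 4 * `|x|)).
apply: le_trans (nodeX_ge _); apply: le_trans (ler_norm x) _.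
by have := truncnS_gt (5 / 4 * `|x|); lra.
Qed.

(** At a node this selects the strip on its left, which contributes the same
    value as the one on its right. *)
Definition strip x : nat := ex_minn (strip_exists x).

Definition glued al be e x : R := piece al be e (strip x) x.

Lemma nodeXS k : nodeX k.+1 = nodeX k + cosk k.+1 :> R.
Proof. by []. Qed.

Lemma nodeX_lt i j : (i < j)%N -> nodeX i < nodeX j :> R.
Proof.
elim: j => // j IH; rewrite ltnS leq_eqVlt nodeXS => /predU1P[->|/IH].
  by rewrite ltrDl.
by have := h0 j; lra.
Qed.

Lemma piece_left al be e k x : x <= nodeX k + c / 4 * cosk k.+1 ->
  piece al be e k x = line al be k x.
Proof.
move=> xk; have rc : reduced k x <= c / 4 by rewrite ler_pdivrMr//; lra.
by rewrite /piece /lift_off switch_eq0// ramp_eq0// subrr mulr0 mul0r subr0 !addr0 mul1r.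
Qed.

Lemma piece_right al be e k x : nodeX k.+1 <= x ->
  piece al be e k x = line al be k.+1 x.
Proof.
rewrite nodeXS => xk; have rc : 1 <= reduced k x by rewrite ler_pdivlMr//; lra.
rewrite /piece /lift_off switch_eq1//; last by have := c01; lra.
by rewrite ramp_eq1// subrr mulr0 mul0r add0r addr0 mul1r.
Qed.

Lemma glued_strip al be e k x : (k == 0)%N || (nodeX k <= x) -> x <= nodeX k.+1 ->
  glued al be e x = piece al be e k x.
Proof.
rewrite /glued /strip; case: ex_minnP => j xj jmin kx xk.
have := jmin _ xk; rewrite leq_eqVlt => /predU1P[->//|jk].
move: kx; rewrite gtn_eqF ?(leq_ltn_trans _ jk)//= => kx.
have ? : k = j.+1.
  apply/eqP; rewrite eqn_leq jk andbT leqNgt; apply/negP => /nodeX_lt.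
  by rewrite ltNge (le_trans kx xj).
subst k; have -> : x = nodeX j.+1 by apply/le_anti; rewrite kx xj.
rewrite piece_right// piece_left// lerDl mulr_ge0//; last exact: ltW.
by have := c0; lra.
Qed.

Lemma glued_line al be e k x :
  nodeX k <= x <= nodeX k + c / 4 * cosk k.+1 -> glued al be e x = line al be k x.
Proof.
move=> /andP[xk kx]; rewrite -(piece_left al be e kx); apply: glued_strip.
  by rewrite xk orbT.
apply: le_trans kx _; rewrite nodeXS lerD2l; have := c01; have := h0 k; nra.
Qed.

(** A piece coincides with the next affine function beyond its strip, and the
    next piece starts with it; so the pieces agree on an overlap, and around
    each point the glued function is a single smooth piece. *)
Lemma glued_near al be e x : exists2 k,
  ((k == 0)%N || (nodeX k <= x)) /\ x <= nodeX k.+1 &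
  \forall z \near x, glued al be e z = piece al be e k z.
Proof.
have [k [kx xk]] : exists k, ((k == 0)%N || (nodeX k < x)) /\ x <= nodeX k.+1.
  exists (strip x); rewrite /strip; case: ex_minnP => j xj jmin; split=> //.
  case: j xj jmin => //= j _ jmin; rewrite ltNge; apply/negP => /jmin.
  by rewrite ltnn.
exists k; first by split=> //; case/orP: kx => [->//|/ltW ->]; rewrite orbT.
have pos : 0 < c / 4 * cosk k.+2.
  by rewrite mulr_gt0//; have := c0; lra.
have nkz : \forall z \near x, (k == 0)%N || (nodeX k < z).
  case/orP: kx => [->|kx]; first by near=> z; rewrite orTb.
  by near=> z; apply/orP; right; near: z; exact: lt_nbhsr.
near=> z; have kz : (k == 0)%N || (nodeX k < z) by near: z.
have [zk|zk] := leP z (nodeX k.+1).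
  by apply: glued_strip => //; case/orP: kz => [->//|/ltW ->]; rewrite orbT.
rewrite piece_right ?ltW// (@glued_line _ _ _ k.+1)// (ltW zk)/=.
apply/ltW; near: z; apply: lt_nbhsl; by rewrite (le_lt_trans xk)// ltrDl.
Unshelve. all: by end_near. Qed.

Lemma smooth_switch : smooth switch.
Proof. exact: (smooth_affine_comp _ _ smooth_sstep). Qed.

Lemma smooth_ramp : smooth ramp.
Proof. exact: (smooth_affine_comp _ _ smooth_sstep). Qed.

(** In the reduced abscissa t every piece is an affine function plus a linear
    combination of [switch t], [t * switch t] and [lift_off t], with
    coefficients controlled by M; the widths of the strips lie in [4/5, 1]. *)
Lemma tame_piece M : exists K, forall al be e,
  (forall k, `|al k| <= M) -> (forall k, `|be k| <= M) -> (forall k, `|e k| <= M) ->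
  forall k, tame K (piece al be e k).
Proof.
have out t : 1 < t -> switch t = 1 /\ ramp t = 1.
  by move=> t1; rewrite switch_eq1 ?ramp_eq1 ?ltW//; have := c01; lra.
have ine t : t < 0 -> switch t = 0 /\ ramp t = 0.
  by move=> t0; rewrite switch_eq0 ?ramp_eq0//; have := c01; lra.
have [K1 K10 t1] : exists2 K, 0 <= K & tame K switch.
  apply: (@tame_affine_outside _ _ 0 1 0 0 1 0) => // [|x /ine[-> _]|x /out[-> _]].
  - exact: smooth_switch.
  - by rewrite mul0r addr0.
  - by rewrite mul0r add0r.
have [K2 K20 t2] : exists2 K, 0 <= K & tame K (fun t => t * switch t).
  apply: (@tame_affine_outside _ _ 0 1 0 0 0 1) => // [|x /ine[-> _]|x /out[-> _]].
  - by apply: smoothM; [exact: smooth_id | exact: smooth_switch].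
  - by rewrite mul0r mulr0 addr0.
  - by rewrite mulr1 mul1r addr0.
have [K3 K30 t3] : exists2 K, 0 <= K & tame K lift_off.
  apply: (@tame_affine_outside _ _ 0 1 0 0 0 0) => // [|x /ine[a b]|x /out[a b]].
  - by apply: smoothB; [exact: smooth_switch | exact: smooth_ramp].
  - by rewrite /lift_off a b mul0r addr0 subrr.
  - by rewrite /lift_off a b mul0r addr0 subrr.
exists (M + 2 ^+ 2 * (3 * M * K1 + 2 * M * K2 + M * K3)) => al be e alM beM eM k.
have M0 : 0 <= M := le_trans (normr_ge0 _) (alM 0%N).
pose g t := (al k.+1 - be k.+1 * cosk k.+1 - al k) * switch t
  + (be k.+1 - be k) * cosk k.+1 * (t * switch t) + e k * lift_off t.
have -> : piece al be e k = fun x => (be k * x + (al k - be k * nodeX k))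
    + g ((cosk k.+1)^-1 * x + - ((cosk k.+1)^-1 * nodeX k)).
  apply/funext => x; rewrite /piece /line nodeXS.
  have E : x = nodeX k + cosk k.+1 * reduced k x.
    by rewrite /reduced [cosk _ * _]mulrC divfK ?gt_eqF// addrC subrK.
  have -> : (cosk k.+1)^-1 * x + - ((cosk k.+1)^-1 * nodeX k) = reduced k x.
    by rewrite /reduced; ring.
  by move: (reduced k x) E => t ->; rewrite /g; ring.
have h1 : `|cosk k.+1| <= 1 :> R.
  by rewrite gtr0_norm//; have := cosk_bounds (R := R) k.+1; lra.
have tg : tame (3 * M * K1 + 2 * M * K2 + M * K3) g.
  apply: tame_add; first apply: tame_add.
  - apply: tame_weaken (tame_scale _ t1); rewrite ler_wpM2r//.
    apply: le_trans (ler_normB _ _) _; apply: le_trans (lerD (ler_normB _ _) (lexx _)) _.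
    have : `|be k.+1 * cosk k.+1| <= M * 1 by rewrite normrM ler_pM.
    by have := alM k; have := alM k.+1; lra.
  - apply: tame_weaken (tame_scale _ t2); rewrite ler_wpM2r// normrM -[2 * M]mulr1.
    apply: ler_pM => //; apply: le_trans (ler_normB _ _) _.
    by have := beM k; have := beM k.+1; lra.
  - by apply: tame_weaken (tame_scale _ t3); rewrite ler_wpM2r.
apply: tame_add.
  by apply: tame_weaken (tame_affine _ _); exact: beM.
apply: tame_affine_comp tg => //; last by lra.
  by rewrite !addr_ge0// mulr_ge0// mulr_ge0//.
rewrite normfV gtr0_norm// -[leRHS]invrK lef_pV2 ?posrE ?invr_gt0//.
by have := coskS_ge (R := R) k; lra.
Qed.

Lemma tame_glued M : exists K, forall al be e,
  (forall k, `|al k| <= M) -> (forall k, `|be k| <= M) -> (forall k, `|e k| <= M) ->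
  tame K (glued al be e).
Proof.
have [K tK] := tame_piece M; exists K => al be e ? ? ?; apply: tame_local => x.
by have [k _ xk] := glued_near al be e x; exists (piece al be e k) => //; apply: tK.
Qed.

Lemma glued_node al be e k : glued al be e (nodeX k) = al k.
Proof.
rewrite (@glued_line _ _ _ k) ?/line ?subrr ?mulr0 ?addr0// lexx lerDl.
by rewrite mulr_ge0//; [have := c0; lra | exact: ltW].
Qed.

Lemma derive1_glued_node al be e k : smooth (glued al be e) ->
  derive1 (glued al be e) (nodeX k) = be k.
Proof.
move=> sg; apply: (@derive1_affine_right _ _ (be k) (al k - be k * nodeX k) _ (c / 4 * cosk k.+1)) => //.
  by rewrite mulr_gt0//; have := c0; lra.
by move=> z /andP[kz zk]; rewrite (@glued_line _ _ _ k) ?kz ?ltW// /line; ring.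
Qed.

End Glueing.

(** * Functions on the plane *)

Section Plane.
Context {R : realType}.
Implicit Types (u v x y : 'rV[R]_2) (f : 'rV[R]_2 -> R) (a b : R -> R).

Definition mkvec (r s : R) : 'rV[R]_2 := \row_i (if i == 0 then r else s).

Lemma mkvec0 r s : mkvec r s 0 0 = r. Proof. by rewrite mxE. Qed.
Lemma mkvec1 r s : mkvec r s 0 1 = s. Proof. by rewrite mxE. Qed.

Lemma ord2P (i : 'I_2) : i = 0 \/ i = 1.
Proof. by case: i => [[|[|m]] im] //; [left | right]; apply/val_inj. Qed.

Lemma vec2P u v : u 0 0 = v 0 0 -> u 0 1 = v 0 1 -> u = v.
Proof.
move=> e0 e1; apply/rowP => i.
by have [->|->] := ord2P i.
Qed.

Lemma dotE u v : dot u v = u 0 0 * v 0 0 + u 0 1 * v 0 1.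
Proof. by rewrite /dot big_ord_recl big_ord1; congr (_ * _ + _ * _); congr (_ _ _); apply/val_inj. Qed.

Lemma dotC u v : dot u v = dot v u.
Proof. by rewrite !dotE mulrC [u 0 1 * _]mulrC. Qed.

Lemma dotZr (r : R) u v : dot u (r *: v) = r * dot u v.
Proof. by rewrite !dotE ![(r *: v) _ _]mxE; ring. Qed.

Lemma enormE u : enorm u = Num.sqrt (u 0 0 ^+ 2 + u 0 1 ^+ 2).
Proof. by rewrite /enorm dotE !expr2. Qed.

Lemma coord_le_enorm u : `|u 0 0| <= enorm u /\ `|u 0 1| <= enorm u.
Proof.
by split; rewrite enormE -sqrtr_sqr ler_sqrt ?lerDl ?lerDr ?addr_ge0 ?sqr_ge0.
Qed.

Lemma enorm_le u : enorm u <= `|u 0 0| + `|u 0 1|.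
Proof.
have p : 0 <= `|u 0 0| + `|u 0 1| by rewrite addr_ge0.
rewrite enormE -[leRHS]ger0_norm// -sqrtr_sqr ler_sqrt ?sqr_ge0//.
rewrite -(real_normK (num_real (u 0 0))) -(real_normK (num_real (u 0 1))).
rewrite sqrrD lerD2r lerDl mulrn_wge0// mulr_ge0//.
Qed.

Lemma derive_line f x v : 'D_v f x = derive1 (fun h : R => f (h *: v + x)) 0.
Proof.
rewrite /derive /derive1; set g1 := (fun h : R => h^-1 *: _).
set g2 := (fun h : R => h^-1 *: _); suff -> : g1 = g2 by [].
by apply/funext => h; rewrite /g1 /g2 addr0 scale0r add0r.
Qed.

Definition tensor a b v : R := a (v 0 0) * b (v 0 1).

Lemma pderiv0_tensor a b : smooth a -> pderiv 0 (tensor a b) = tensor (derive1 a) b.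
Proof.
move=> sa; apply/funext => v; rewrite /pderiv derive_line.
have -> : (fun h : R => tensor a b (h *: delta_mx 0 0 + v)) =
          (fun h => b (v 0 1) * a (1 * h + v 0 0)).
  by apply/funext => h; rewrite /tensor !mxE/= mulr1 mulr0 add0r mul1r mulrC.
rewrite derive1_mul; [|exact: smooth_cst|exact: smooth_affine_comp].
rewrite (derive1_cst (b (v 0 1))) mulr0 addr0.
by rewrite derive1_affine_comp// mul1r mulr0 add0r mulrC.
Qed.

Lemma pderiv1_tensor a b : smooth b -> pderiv 1 (tensor a b) = tensor a (derive1 b).
Proof.
move=> sb; apply/funext => v; rewrite /pderiv derive_line.
have -> : (fun h : R => tensor a b (h *: delta_mx 0 1 + v)) =
          (fun h => a (v 0 0) * b (1 * h + v 0 1)).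
  by apply/funext => h; rewrite /tensor !mxE/= mulr1 mulr0 add0r mul1r.
rewrite derive1_mul; [|exact: smooth_cst|exact: smooth_affine_comp].
rewrite (derive1_cst (a (v 0 0))) mulr0 addr0.
by rewrite derive1_affine_comp// mul1r mulr0 add0r.
Qed.

Lemma differentiable_tensor a b v : smooth a -> smooth b ->
  differentiable (tensor a b) v.
Proof.
move=> sa sb; apply: differentiableM.
  apply: (@differentiable_comp _ _ _ _ (fun w : 'rV[R]_2 => w 0 0) a).
    exact: differentiable_coord.
  by apply/derivable1_diffP; have [] := smooth_is_derive (v 0 0) sa.
apply: (@differentiable_comp _ _ _ _ (fun w : 'rV[R]_2 => w 0 1) b).
  exact: differentiable_coord.
by apply/derivable1_diffP; have [] := smooth_is_derive (v 0 1) sb.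
Qed.

Lemma Cn_tensor k a b : smooth a -> smooth b -> Cn k (tensor a b).
Proof.
elim: k a b => [|k IH] a b sa sb /=.
  by move=> v; apply/differentiable_continuous/differentiable_tensor.
split=> [v|i]; first exact: differentiable_tensor.
have [->|->] := ord2P i; rewrite ?pderiv0_tensor ?pderiv1_tensor//.
  by apply: IH => //; exact: smooth_derive1.
by apply: IH => //; exact: smooth_derive1.
Qed.

Lemma pderivD i (f g : 'rV[R]_2 -> R) :
  (forall x, differentiable f x) -> (forall x, differentiable g x) ->
  pderiv i (fun x => f x + g x) = (fun x => pderiv i f x + pderiv i g x).
Proof.
by move=> df dg; apply/funext => x; rewrite /pderiv deriveD//; exact: diff_derivable.
Qed.

Lemma CnD k (f g : 'rV[R]_2 -> R) : Cn k f -> Cn k g -> Cn k (fun x => f x + g x).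
Proof.
elim: k f g => [|k IH] f g /=; first by move=> cf cg x; exact: (continuousD (cf x) (cg x)).
move=> [df fi] [dg gi]; split=> [x|i]; first exact: differentiableD.
by rewrite pderivD//; exact: IH.
Qed.

Section Model.
Variables (A B psi : R -> R) (K : R).
Hypotheses (tA : tame K A) (tB : tame K B) (tpsi : tame K psi).
Hypotheses (Bbd : forall t, `|B t| <= K) (psibd : forall t, `|psi t| <= K).

Definition model v : R := A (v 0 0) + B (v 0 0) * psi (v 0 1).

Let sA : smooth A. Proof. by case: tA. Qed.
Let sB : smooth B. Proof. by case: tB. Qed.
Let spsi : smooth psi. Proof. by case: tpsi. Qed.

Let modelE : model = fun v => tensor A (fun=> 1) v + tensor B psi v.
Proof. by apply/funext => v; rewrite /model /tensor mulr1. Qed.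

Lemma Cinfty_model : Cinfty model.
Proof. by move=> k; rewrite modelE; apply: CnD; apply: Cn_tensor => //; exact: smooth_cst. Qed.

Lemma grad_model v : grad model v =
  mkvec (derive1 A (v 0 0) + derive1 B (v 0 0) * psi (v 0 1))
        (B (v 0 0) * derive1 psi (v 0 1)).
Proof.
have s1 : smooth (fun=> 1 : R) := smooth_cst 1.
have d x : differentiable (tensor A (fun=> 1)) x by exact: differentiable_tensor.
have d' x : differentiable (tensor B psi) x by exact: differentiable_tensor.
apply: vec2P; rewrite mxE modelE pderivD//.
  by rewrite !pderiv0_tensor// mkvec0 /tensor mulr1.
by rewrite !pderiv1_tensor// mkvec1 /tensor (derive1_cst (1 : R)) mulr0 add0r.
Qed.

Let prod_lipschitz (g h : R -> R) (v w : 'rV[R]_2) :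
  (forall t, `|g t| <= K) -> (forall t, `|h t| <= K) ->
  (forall s t, `|g s - g t| <= K * `|s - t|) ->
  (forall s t, `|h s - h t| <= K * `|s - t|) ->
  `|g (v 0 0) * h (v 0 1) - g (w 0 0) * h (w 0 1)| <= 2 * K ^+ 2 * enorm (v - w).
Proof.
move=> gK hK gl hl.
have K0 : 0 <= K := le_trans (normr_ge0 _) (gK 0).
have [] := coord_le_enorm (v - w); rewrite !mxE => n0 n1.
have -> : g (v 0 0) * h (v 0 1) - g (w 0 0) * h (w 0 1) =
  (g (v 0 0) - g (w 0 0)) * h (v 0 1) + g (w 0 0) * (h (v 0 1) - h (w 0 1)) by ring.
apply: le_trans (ler_normD _ _) _; rewrite !normrM.
have -> : 2 * K ^+ 2 * enorm (v - w) = (K * enorm (v - w)) * K + K * (K * enorm (v - w)) by ring.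
apply: lerD; apply: ler_pM => //.
  by apply: le_trans (gl _ _) _; rewrite ler_wpM2l.
by apply: le_trans (hl _ _) _; rewrite ler_wpM2l.
Qed.

Lemma lipschitz_grad_model : lipschitz_grad model.
Proof.
exists (K + 4 * K ^+ 2) => v w.
have K0 : 0 <= K := le_trans (normr_ge0 _) (Bbd 0).
rewrite !grad_model; apply: le_trans (enorm_le _) _; rewrite !mxE/=.
have p0 : `|derive1 A (v 0 0) - derive1 A (w 0 0)| <= K * enorm (v - w).
  apply: le_trans (tame_derive1_lipschitz tA _ _) _; rewrite ler_wpM2l//.
  by have [] := coord_le_enorm (v - w); rewrite !mxE.
have [_ dB _] := tB; have [_ dpsi _] := tpsi.
have p1 := @prod_lipschitz (derive1 B) psi v w.
have p2 := @prod_lipschitz B (derive1 psi) v w.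
have {}p1 := p1 dB psibd (tame_derive1_lipschitz tB) (tame_lipschitz tpsi).
have {}p2 := p2 Bbd dpsi (tame_lipschitz tB) (tame_derive1_lipschitz tpsi).
have -> : (K + 4 * K ^+ 2) * enorm (v - w) = K * enorm (v - w)
  + 2 * K ^+ 2 * enorm (v - w) + 2 * K ^+ 2 * enorm (v - w) by ring.
apply: lerD => //; rewrite opprD addrACA.
by apply: le_trans (ler_normD _ _) _; exact: lerD.
Qed.

End Model.
End Plane.

(** * The objective function and its values along the zigzag *)

Section Descent.
Context {R : realType}.
Variable c : R.
Hypothesis c01 : 0 < c < 1.
Implicit Types s t : R.

(** The decrease along a segment, in units of its initial slope: the blend of
    [t] (the first Taylor model) and [c] (the second one, constant along the
    segment), corrected by [lift_off] to be strictly increasing. *)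
Definition descent t : R :=
  (1 - switch c t) * t + switch c t * c - c / 2 * lift_off c t.

Lemma descent0 : descent 0 = 0.
Proof.
have c4 : 0 <= c / 4 by have := c01; lra.
by rewrite /descent /lift_off switch_eq0// ramp_eq0// !mulr0 mul0r subrr mulr0 subr0 addr0.
Qed.

Lemma descent_lt s t : 0 <= s -> s < t -> t <= 1 -> descent s < descent t.
Proof.
move=> s0 st t1; have /andP[c0 c1] := c01.
(* The term [c / 2 - (c / 2 - u) * (1 - switch u)] is nondecreasing, since
   [switch] is 1 beyond c/2; beyond c/4 the ramp makes the sum strict. *)
have E u : descent u = c / 2 - (c / 2 - u) * (1 - switch c u) + c / 2 * ramp c u.
  by rewrite /descent /lift_off; field.
have [tc|tc] := leP t (c / 4).
  rewrite !E !switch_eq0 ?ramp_eq0//; lra.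
have rst : ramp c s < ramp c t by apply: ramp_lt => //; lra.
have sst := switch_le c01 (ltW st).
have /andP[_ bs] := switch_bounds c s; have /andP[_ bt] := switch_bounds c t.
rewrite !E ler_ltD ?ltr_pM2l//; last by lra.
rewrite lerD2l lerN2.
have [tc2|tc2] := leP t (c / 2); first by apply: ler_pM; lra.
rewrite (switch_eq1 c01 (ltW tc2)) subrr mulr0.
have [sc2|sc2] := leP s (c / 2); first by apply: mulr_ge0; lra.
by rewrite (switch_eq1 c01 (ltW sc2)) subrr mulr0.
Qed.

End Descent.

Section Objective.
Context {R : realType}.
Variable c : R.
Hypothesis c01 : 0 < c < 1.
Implicit Types (k : nat) (t : R) (v : 'rV[R]_2).

Definition node k : 'rV[R]_2 := mkvec (nodeX k) (nodeY k).
Definition dir k : 'rV[R]_2 := mkvec (cosk k.+1) (- ((-1) ^+ k * sink k.+1)).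
Definition gvec k : 'rV[R]_2 := mkvec (- sink k) ((-1) ^+ k * cosk k).

Lemma nodeS k : node k.+1 = node k + dir k.
Proof. by apply: vec2P; rewrite !mxE. Qed.

Let sgn2 k : (-1) ^+ k * (-1) ^+ k = 1 :> R.
Proof. by rewrite -expr2 sqrr_sign. Qed.

Lemma enorm_dir k : enorm (dir k) = 1.
Proof.
rewrite enormE mkvec0 mkvec1 sqrrN exprMn sqrr_sign mul1r sink_sqr.
by rewrite addrC subrK sqrtr1.
Qed.

Lemma enorm_gvec k : enorm (gvec k) = 1.
Proof.
rewrite enormE mkvec0 mkvec1 sqrrN exprMn sqrr_sign mul1r sink_sqr.
by rewrite subrK sqrtr1.
Qed.

Lemma dot_gvec_dir k : dot (gvec k) (dir k) = - slope k.
Proof.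
rewrite dotE !mkvec0 !mkvec1 /slope mulrN mulrACA sgn2; ring.
Qed.

Lemma dot_gvecS_dir k : dot (gvec k.+1) (dir k) = 0.
Proof.
by rewrite dotE !mkvec0 !mkvec1 exprS mulN1r mulrN !mulNr opprK mulrACA sgn2; ring.
Qed.

Lemma gvec0 : gvec 0 = - dir 0.
Proof.
apply: vec2P; first by rewrite mkvec0 mxE mkvec0 sink0.
by rewrite mkvec1 mxE mkvec1 !expr0 !mul1r opprK sink1.
Qed.

(** In the plane the class condition determines the direction up to a scalar. *)
Lemma orthogonal_dir k (d : 'rV[R]_2) : dot d (gvec k.+1 - gvec k) = 0 ->
  d = (d 0 0 / cosk k.+2) *: dir k.+1.
Proof.
rewrite dotE [X in _ * X + _]mxE [X in _ + _ * X]mxE [X in _ * (_ + X) + _]mxE.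
rewrite [X in _ + _ * (_ + X)]mxE !mkvec0 !mkvec1 exprS mulN1r => H.
have c2 := coskS_ge (R := R) k.+1; have c1 := coskS_ge (R := R) k.
have /andP[c0 _] := cosk_bounds (R := R) k.
have bi := bisector_identity (R := R) k.
apply: vec2P; rewrite mxE ?mkvec0 ?mkvec1 ?exprS ?mulN1r ?divfK ?gt_eqF//; try lra.
have := sgn2 k; move: ((-1) ^+ k) H => sg H s1.
have w0 : cosk k + cosk k.+1 != 0 :> R by rewrite gt_eqF//; lra.
have C0 : cosk k.+2 != 0 :> R by rewrite gt_eqF//; lra.
apply: (mulIf w0).
rewrite (_ : _ * - _ * _ = d 0 0 / cosk k.+2 * (sg * (sink k.+2 * (cosk k + cosk k.+1)))); last by ring.
rewrite -bi.
have -> : d 0 1 * (cosk k + cosk k.+1) = sg * (d 0 0 * (sink k - sink k.+1)).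
  have -> : d 0 0 * (sink k - sink k.+1) = d 0 1 * sg * (cosk k + cosk k.+1).
    by apply/eqP; rewrite -subr_eq0; apply/eqP; rewrite -H; ring.
  by rewrite !mulrA [sg * _]mulrC -[d 0 1 * sg * sg]mulrA s1 mulr1.
rewrite [RHS]mulrCA; congr (_ * _).
by rewrite -[in RHS]mulrA mulKf.
Qed.

(** The coefficients are those of the Taylor models [taylor k], sorted by their
    dependence on the ordinate. *)
Definition profileA : R -> R :=
  glued c (fun k => level c k - (-1) ^+ k * cosk k * nodeY k)
    (fun k => - sink k) (fun k => c * slope k / 2).

Definition profileB : R -> R :=
  glued c (fun k => (-1) ^+ k * cosk k) (fun=> 0) (fun=> 0).

Definition objective : 'rV[R]_2 -> R := model profileA profileB (@trunc_id R).

Definition taylor k v : R :=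
  level c k - sink k * (v 0 0 - nodeX k)
  + (-1) ^+ k * cosk k * (trunc_id (v 0 1) - nodeY k).

Lemma objective_strip k v :
  (k == 0)%N || (nodeX k <= v 0 0) -> v 0 0 <= nodeX k.+1 ->
  objective v = (1 - switch c (reduced k (v 0 0))) * taylor k v
    + switch c (reduced k (v 0 0)) * taylor k.+1 v
    + c * slope k / 2 * lift_off c (reduced k (v 0 0)).
Proof.
move=> kx xk; rewrite /objective /model /profileA /profileB !(glued_strip c01 _ _ _ kx xk).
by rewrite /piece /line /taylor; ring.
Qed.

Lemma objective_after k v : nodeX k <= v 0 0 <= nodeX k + c / 4 * cosk k.+1 ->
  objective v = taylor k v.
Proof.
move=> vk; rewrite /objective /model /profileA /profileB !(glued_line c01 _ _ _ vk).
by rewrite /line /taylor; ring.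
Qed.

Lemma path_coordX k t : (node k + t *: dir k) 0 0 = nodeX k + t * cosk k.+1.
Proof. by rewrite !mxE. Qed.

Lemma path_coordY k t : (node k + t *: dir k) 0 1 = nodeY k - (-1) ^+ k * (t * sink k.+1).
Proof. by rewrite !mxE/= mulrN mulrCA. Qed.

Lemma path_trunc_id k t : 0 <= t <= 2 ->
  trunc_id ((node k + t *: dir k) 0 1) = (node k + t *: dir k) 0 1.
Proof.
move=> /andP[t0 t2]; apply: trunc_idE; rewrite -ler_norml path_coordY.
apply: le_trans (ler_normB _ _) _; rewrite normrM normrX normrN1 expr1n mul1r.
have a := sink_gt0 (R := R) k.+1; have b := nodeY_bound (R := R) k.
have d := sink_decay (R := R) k.
rewrite ger0_norm; last by apply: mulr_ge0 => //; exact: ltW.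
nra.
Qed.

Lemma taylor_path k t : 0 <= t <= 2 ->
  taylor k (node k + t *: dir k) = level c k - t * slope k.
Proof.
move=> t2; rewrite /taylor path_trunc_id// path_coordX path_coordY /slope.
have := sgn2 k; move: ((-1) ^+ k) => sg s1.
rewrite [X in _ + X](_ : _ = - (sg * sg) * cosk k * t * sink k.+1); last by ring.
by rewrite s1; ring.
Qed.

(** The next gradient is orthogonal to the step and the next node lies on the
    line, so the next Taylor model is constant along it. *)
Lemma taylorS_path k t : 0 <= t <= 2 ->
  taylor k.+1 (node k + t *: dir k) = level c k.+1.
Proof.
move=> t2; rewrite /taylor path_trunc_id// path_coordX path_coordY.
rewrite /nodeX /nodeY -/nodeX -/nodeY exprS.
have := sgn2 k; move: ((-1) ^+ k) => sg s1.
rewrite [X in _ + X](_ : _ = (sg * sg) * (t - 1) * (cosk k.+1 * sink k.+1)); last by ring.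
by rewrite s1; ring.
Qed.

Lemma objective_path k t : 0 <= t <= 1 ->
  objective (node k + t *: dir k) = level c k - slope k * descent c t.
Proof.
move=> /andP[t0 t1]; have c1 := coskS_ge (R := R) k.
have t2 : 0 <= t <= 2 by lra.
rewrite (@objective_strip k).
- rewrite taylor_path// taylorS_path// path_coordX.
  have -> : reduced k (nodeX k + t * cosk k.+1) = t.
    by rewrite /reduced addrC addKr mulfK// gt_eqF//; lra.
  by rewrite /descent /level -/(level c k); field.
- by rewrite path_coordX; apply/orP; right; rewrite lerDl mulr_ge0//; lra.
- by rewrite path_coordX nodeXS lerD2l ler_piMl//; lra.
Qed.

(** The next strip has width at least 4/5 and its piece is affine on the first
    c/4 of it, hence the constant c/5. *)
Lemma objective_past k t : 1 <= t <= 1 + c / 5 ->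
  objective (node k + t *: dir k) = level c k.+1.
Proof.
move=> /andP[t0 t1]; have a := coskS_ge (R := R) k.+1; have b := coskS_ge (R := R) k.
have /andP[_ d] := cosk_bounds (R := R) k.+1; have /andP[c0 c1] := c01.
rewrite (@objective_after k.+1) ?taylorS_path//; first by lra.
by rewrite path_coordX nodeXS; nra.
Qed.

Lemma objective_node k : objective (node k) = level c k.
Proof.
have := @objective_path k 0; rewrite scale0r addr0 descent0// mulr0 subr0.
by apply; lra.
Qed.

Lemma profile_tame : exists K, [/\ tame K profileA, tame K profileB,
  tame K (@trunc_id R), (forall t, `|profileB t| <= K) & forall t, `|trunc_id t| <= K].
Proof.
have /andP[c0 c1] := c01.
have b1 k : `|(-1) ^+ k * cosk k| <= 1 :> R.
  rewrite normrM normrX normrN1 expr1n mul1r.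
  by have /andP[a b] := cosk_bounds (R := R) k; rewrite ger0_norm; lra.
have y2 k : `|nodeY k| <= 2 :> R.
  by have := nodeY_bound (R := R) k; have := sink_gt0 (R := R) k; lra.
have s1 k : `|sink k| <= 1 :> R.
  by have a := sink_le1 (R := R) k; have b := sink_gt0 (R := R) k; rewrite gtr0_norm.
have [K tK] := tame_glued c01 8; have [L L0 tL] := tame_trunc_id (R := R).
have tA : tame K profileA.
  apply: tK => k; last 2 first.
  - by rewrite normrN; have := s1 k; lra.
  - have a := slope_gt0 (R := R) k; have b := slope_le (R := R) k.
    have d := sink_le1 (R := R) k; rewrite ger0_norm; nra.
  apply: le_trans (ler_normB _ _) _; rewrite normrM.
  have l6 : `|level c k| <= 6.
    by have /andP[a b] := level_bound k c01; rewrite ler_norml; lra.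
  have : `|(-1) ^+ k * cosk k| * `|nodeY k| <= 1 * 2 :> R by apply: ler_pM.
  lra.
have tB : tame K profileB.
  by apply: tK => k; rewrite ?normr0//; have := b1 k; lra.
exists (Num.max (Num.max K L) 3); split.
- by apply: tame_weaken tA; rewrite !le_max lexx.
- by apply: tame_weaken tB; rewrite !le_max lexx.
- by apply: tame_weaken tL; rewrite !le_max lexx orbT.
- move=> t; rewrite le_max; apply/orP; right.
  have [k [kx xk] _] := glued_near c01 (fun=> 0) (fun=> 0) (fun=> 0) t.
  rewrite /profileB (glued_strip c01 _ _ _ kx xk) /piece /line !mul0r !addr0.
  have /andP[a b] := switch_bounds c (reduced k t).
  apply: le_trans (ler_normD _ _) _; rewrite [X in X + _]normrM [X in _ + X]normrM.
  rewrite [`|1 - _|]ger0_norm ?subr_ge0// [`|switch c _|]ger0_norm//.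
  by have := b1 k; have := b1 k.+1; move: `|_| `|_| (switch _ _) a b => ? ? ? *; nra.
- by move=> t; rewrite le_max trunc_id_bound orbT.
Qed.

Lemma Cinfty_objective : Cinfty objective.
Proof. by have [K [tA tB tp _ _]] := profile_tame; exact: Cinfty_model tA tB tp. Qed.

Lemma lipschitz_grad_objective : lipschitz_grad objective.
Proof. by have [K [tA tB tp bB bp]] := profile_tame; exact: lipschitz_grad_model tA tB tp bB bp. Qed.

Lemma bounded_below_objective : bounded_below objective.
Proof.
exists (- 20) => v.
have [k [kx xk] _] := glued_near c01 (fun=> 0) (fun=> 0) (fun=> 0) (v 0 0).
rewrite (objective_strip kx xk).
have T j : v 0 0 <= nodeX j + 1 -> - 12 <= taylor j v.
  move=> vj; have /andP[a b] := level_bound j c01.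
  have d := sink_le1 (R := R) j; have e := sink_gt0 (R := R) j.
  have : `|(-1) ^+ j * cosk j * (trunc_id (v 0 1) - nodeY j)| <= 1 * 5.
    rewrite normrM; apply: ler_pM => //.
      rewrite normrM normrX normrN1 expr1n mul1r.
      by have /andP[? ?] := cosk_bounds (R := R) j; rewrite ger0_norm; lra.
    apply: le_trans (ler_normB _ _) _.
    by have := trunc_id_bound (v 0 1); have := nodeY_bound (R := R) j; lra.
  rewrite ler_norml => /andP[f _]; rewrite /taylor.
  have : sink j * (v 0 0 - nodeX j) <= 1 by nra.
  lra.
have /andP[_ d] := cosk_bounds (R := R) k.+1; have /andP[_ d'] := cosk_bounds (R := R) k.+2.
have {}T0 : - 12 <= taylor k v by apply: T; move: xk; rewrite nodeXS; lra.
have {}T1 : - 12 <= taylor k.+1 v by apply: T; lra.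
have /andP[a b] := switch_bounds c (reduced k (v 0 0)).
have /andP[a' b'] := ramp_bounds c (reduced k (v 0 0)).
have e := slope_gt0 (R := R) k; have f := slope_le (R := R) k; have g := sink_le1 (R := R) k.
have /andP[c0 c1] := c01.
have m : 0 <= c * slope k / 2 <= 1 by nra.
rewrite /lift_off; move: (switch _ _) (ramp _ _) (c * slope k / 2) a b a' b' m => p q r *; nra.
Qed.

(** To the right of each node the profiles are affine. *)
Lemma grad_objective_node k : grad objective (node k) = gvec k.
Proof.
have [K [tA tB tp _ _]] := profile_tame; rewrite (grad_model tA tB tp).
have {tA tB} [[sA _ _] [sB _ _]] := (tA, tB).
rewrite mkvec0 mkvec1 /profileA /profileB !derive1_glued_node// glued_node// mul0r addr0.
suff -> : derive1 trunc_id (nodeY k) = 1 :> R by rewrite mulr1.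
have b := nodeY_bound (R := R) k; have s := sink_gt0 (R := R) k.
apply: (@derive1_affine_right _ _ 1 0 _ (sink k)) => //; first exact: smooth_trunc_id.
move=> z /andP[z1 z2]; rewrite mul1r addr0 trunc_idE//.
have : `|nodeY k| <= 2 - 2 * sink k :> R by lra.
by rewrite ler_norml => /andP[? ?]; lra.
Qed.

End Objective.

(** * Executions of the methods of the class *)

Section Execution.
Context {R : realType}.
Variable c : R.
Hypothesis c01 : 0 < c < 1.
Implicit Types (k : nat) (t lam : R).

Lemma first_local_minimizer_unique (phi : R -> R) s t :
  first_local_minimizer phi s -> first_local_minimizer phi t -> s = t.
Proof. by move=> [ms s1] [mt t1]; apply/le_anti; rewrite s1// t1. Qed.

(** Local minimizers need not be strict, so being constant just past 1 is
    enough. *)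
Lemma first_local_minimizer_scaled (F : R -> R) (lam e : R) : 0 < lam -> 0 < e ->
  (forall s t : R, 0 <= s -> s < t -> t <= 1 -> F t < F s) ->
  (forall t, 1 <= t <= 1 + e -> F t = F 1) ->
  first_local_minimizer (fun u => F (u * lam)) lam^-1.
Proof.
move=> l0 e0 Fdec Fcst; split.
  split; first by rewrite invr_ge0 ltW.
  rewrite mulVf ?gt_eqF//; near=> u => u0.
  have [ul|ul] := leP 1 (u * lam).
    rewrite [F (u * lam)]Fcst//; apply/andP; split=> //.
    rewrite -ler_pdivlMr//; apply/ltW; near: u; apply: lt_nbhsl.
    by rewrite ltr_pdivlMr// mulVf ?gt_eqF// ltrDl.
  by apply/ltW/Fdec => //; rewrite mulr_ge0// ltW.
move=> w [w0 wmin]; rewrite leNgt; apply/negP => wl.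
have : \forall u \near w^'+, False.
  have nw : \forall u \near w^'+, 0 <= u -> F (w * lam) <= F (u * lam).
    exact: cvg_within wmin.
  near=> u.
  have wu : w < u by near: u; exact: nbhs_right_gt.
  have ul : u < lam^-1 by near: u; exact: nbhs_right_lt.
  have : F (w * lam) <= F (u * lam).
    by have : 0 <= u := le_trans w0 (ltW wu); near: u.
  rewrite leNgt Fdec//; first by rewrite mulr_ge0// ltW.
    by rewrite ltr_pM2r.
  by rewrite -ler_pdivlMr// mul1r ltW.
by move=> /filter_ex[].
Unshelve. all: by end_near. Qed.

(** The positive factor [lam] accounts for the norm of the search direction, the
    only thing that the method is free to choose. *)
Lemma line_search k lam (d : 'rV[R]_2) : 0 < lam -> d = lam *: dir k ->
  first_local_minimizer (fun u => objective c (node k + u *: d)) lam^-1.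
Proof.
move=> l0 ->; have /andP[c0 c1] := c01.
pose F t := objective c (node k + t *: dir k).
have -> : (fun u : R => objective c (node k + u *: (lam *: dir k))) =
    (fun u => F (u * lam)) by apply/funext => u; rewrite scalerA.
apply: (@first_local_minimizer_scaled F lam (c / 5)) => //; first by lra.
  move=> s t s0 st t1; rewrite /F !objective_path//.
  - by rewrite ltrD2l ltrN2 ltr_pM2l ?slope_gt0// descent_lt.
  - by rewrite s0 (le_trans (ltW st)).
  - by rewrite t1 (le_trans s0 (ltW st)).
move=> t t1; rewrite /F !objective_past// lexx/=; lra.
Qed.

Variable M : method R 2.
Hypothesis MC : classC M.
Variable m0 : memory M.
Hypothesis m0_adm : admissible (objective c) (node 0) (- grad (objective c) (node 0)) m0.

Section Prefix.
Variables (x d : nat -> 'rV[R]_2) (m : nat -> memory M).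
Hypotheses (x0E : x 0 = node 0) (d0E : d 0 = - grad (objective c) (node 0)).
Hypothesis (m0E : m 0 = m0).

(** Stated for finite prefixes, so that it serves both to construct an execution
    and to describe a given one. *)
Lemma execution_prefix k : (forall j, (j < k)%N -> step (objective c) x d m j) ->
  x k = node k /\ exists2 lam, 0 < lam & d k = lam *: dir k.
Proof.
elim: k => [|k IH] steps.
  split=> //; exists 1; first exact: ltr01.
  by rewrite d0E grad_objective_node// gvec0 opprK scale1r.
have [j jk|xk [lam l0 dk]] := IH; first by apply: steps; exact: ltnW.
have xS : x k.+1 = node k.+1.
  have [[t [tmin ->]] _] := steps k (ltnSn k).
  rewrite xk in tmin *; rewrite (first_local_minimizer_unique tmin (line_search l0 dk)).
  by rewrite dk scalerA mulVf ?gt_eqF// scale1r nodeS.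
split=> //.
have [|||||o ds] := MC (f := objective c) (x := x) (d := d) (m := m) (k := k).
- exact: (Cinfty_objective c01 1).
- by rewrite x0E d0E m0E.
- by move=> j jk; apply: steps; rewrite ltnS.
- rewrite xS grad_objective_node// => g0; have := enorm_gvec (R := R) k.+1.
  by rewrite g0 enormE !mxE expr0n addr0 sqrtr0 => /esym/eqP; rewrite oner_eq0.
- rewrite xS grad_objective_node// dk.
  by rewrite dotZr dot_gvecS_dir mulr0.
move: o ds; rewrite xS xk !grad_objective_node// => o ds.
have dE := orthogonal_dir o; exists (d k.+1 0 0 / cosk k.+2) => //.
move: ds; rewrite {1}dE dotC dotZr dot_gvec_dir mulrN oppr_lt0.
by rewrite pmulr_lgt0 ?slope_gt0.
Qed.

End Prefix.

Lemma execution_exists : exists (x d : nat -> 'rV[R]_2) (m : nat -> memory M),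
  execution (objective c) (node 0) (- grad (objective c) (node 0)) m0 x d m.
Proof.
pose st := fix st k : memory M * 'rV[R]_2 :=
  if k is k'.+1
  then update (objective c) (st k').1 (node k') (st k').2 (node k'.+1)
  else (m0, - grad (objective c) (node 0)).
exists (@node R), (fun k => (st k).2), (fun k => (st k).1); split=> // k.
suff : forall j, (j < k.+1)%N ->
    step (objective c) (@node R) (fun k => (st k).2) (fun k => (st k).1) j by apply.
elim: k.+1 => // n IH j; rewrite ltnS leq_eqVlt => /predU1P[->|/IH//].
have [_ [lam l0 dn]] := execution_prefix (x := @node R) (d := fun k => (st k).2)
  (m := fun k => (st k).1) erefl erefl erefl IH.
split; last by rewrite -surjective_pairing.
exists lam^-1; split; first exact: line_search.
by rewrite dn scalerA mulVf ?gt_eqF// scale1r nodeS.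
Qed.

Lemma execution_iterates (x d : nat -> 'rV[R]_2) (m : nat -> memory M) k :
  execution (objective c) (node 0) (- grad (objective c) (node 0)) m0 x d m ->
  x k = node k.
Proof. by move=> [x0 d0 mm0 st]; have [] := execution_prefix x0 d0 mm0 (fun j _ => st j) (k := k). Qed.

End Execution.

Theorem theorem1 (R : realType) (c1 c2 : R) (hc1 : 0 < c1) (hc12 : c1 < c2)
    (hc2 : c2 < 1) :
  exists (f : 'rV[R]_2 -> R) (x0 : 'rV[R]_2),
    [/\ Cinfty f, bounded_below f, lipschitz_grad f &
      forall M : method R 2, classC M ->
      forall m0 : memory M, admissible f x0 (- grad f x0) m0 ->
        (exists (x d : nat -> 'rV[R]_2) (m : nat -> memory M),
           execution f x0 (- grad f x0) m0 x d m) /\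
        (forall (x d : nat -> 'rV[R]_2) (m : nat -> memory M),
           execution f x0 (- grad f x0) m0 x d m ->
           forall k : nat, let s := x k.+1 - x k in
             [/\ enorm s = 1,
                 enorm (grad f (x k)) = 1 &
                 [/\ strong_wolfe f c1 c2 (x k) s,
                     weak_wolfe f c1 c2 (x k) s,
                     armijo f c1 (x k) s &
                     goldstein f c1 c2 (x k) s]])].
Proof.
have c01 : 0 < c1 < 1 by rewrite hc1 (lt_trans hc12).
exists (objective c1), (node 0); split.
- exact: Cinfty_objective.
- exact: bounded_below_objective.
- exact: lipschitz_grad_objective.
move=> M MC m0 adm; split; first exact: execution_exists.
move=> x d m ex k; rewrite !(execution_iterates c01 MC adm _ ex).
have -> : node k.+1 - node k = dir k :> 'rV[R]_2 by rewrite nodeS addrC addKr.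
move=> s; rewrite /strong_wolfe /weak_wolfe /goldstein /armijo.
rewrite /s -nodeS !grad_objective_node// !objective_node//.
rewrite enorm_dir enorm_gvec dot_gvec_dir dot_gvecS_dir normr0.
have sl := slope_gt0 (R := R) k.
have l : level c1 k.+1 = level c1 k - c1 * slope k by [].
have a : level c1 k.+1 <= level c1 k + c1 * - slope k by rewrite l mulrN.
split=> //; split=> //; do ?split=> //.
- by rewrite mulr_ge0// ltW// (lt_trans hc1).
- by rewrite mulrN oppr_le0 mulr_ge0 ?ltW// (lt_trans hc1).
- by rewrite a andbT l mulrN lerD2l lerN2 ler_pM2r// ltW.
Qed.
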